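(* For any non-empty labeled poset $(P,\omega)$, $$K(P,\omega;x)=\sum_{\emptyset\ne S\in\mathcal I_\omega(P)}\Lambda_{|S|}\,K(P\setminus S,\omega;x).$$
   Context: All posets are finite and $\mathbb N^+=\{1,2,\dots\}$. An ideal of a poset $P$ is a down-closed subset (including $\emptyset$ and $P$). A labeled poset $(P,\omega)$ is a finite poset $P$ with an injective map $\omega:P\to\mathbb N^+$; each subset $S\subseteq P$ carries the induced order and labeling, giving a labeled poset $(S,\omega)$. A subset $S$ is $\omega$-natural if $\omega|_S$ is order-preserving; $\mathcal I_\omega(P)$ is the set of ideals of $P$ that are $\omega$-natural. A map $\sigma:P\to\mathbb N^+$ is $\omega$-order-preserving if it is order-preserving and $\sigma(x)>\sigma(y)$ whenever $x>y$ in $P$ and $\omega(x)<\omega(y)$. Let $x=(x_1,x_2,\dots)$ be commuting variables and $\mathbb C[[x]]$ the formal power series algebra in them. For a map $\sigma:P\to\mathbb N^+$ put $x^\sigma=\prod_{i\ge1}x_i^{|\sigma^{-1}(i)|}$, and define $$K(P,\omega;x)=\sum_\sigma x^\sigma\in\mathbb C[[x]],$$ the sum over all $\omega$-order-preserving maps $\sigma:P\to\mathbb N^+$ (so $K(\emptyset,\omega;x)=1$). Let $T:\mathbb C[[x]]\to\mathbb C[[x]]$ be the shift, i.e. the $\mathbb C$-algebra homomorphism substituting $x_m\mapsto x_{m+1}$ for all $m\ge1$ (so $T(1)=1$ and $(Tf)(x_1,x_2,\dots)=f(x_2,x_3,\dots)$). For $m\in\mathbb N^+$ define the linear operator $$\Lambda_m=\sum_{k=1}^\infty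 x_k^m\,T^k$$ on $\mathbb C[[x]]$. *)

(* Defs.v *)
From HB Require Import structures.
From mathcomp Require Import all_boot all_order all_algebra finmap.
From mathcomp Require Import boolp classical_sets functions cardinality fsbigop.
From mathcomp Require Import reals complex.
From mathcomp.multinomials Require Import monalg.

Set Implicit Arguments.
Unset Strict Implicit.
Unset Printing Implicit Defensive.

Import Order.TTheory GRing.Theory.
Local Open Scope classical_set_scope.
Local Open Scope ring_scope.

Fact posn_display : Order.disp_t. Proof. exact: Order.Disp tt tt. Qed.

Definition posn : Type := {n : nat | (0 < n)%N}.
HB.instance Definition _ := SubCountable.on posn.
HB.instance Definition _ :=
  [SubChoice_isSubOrder of posn by <: with posn_display].

Definition posn_succ (k : posn) : posn := exist _ (val k).+1 isT.

(* The variables are x_i for i : posn; an element of [monomial] is a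
   finitely supported exponent function. *)
Notation monomial := {cmonom posn}.

Record fps (R : Type) := Fps { fps_coef : monomial -> R }.

Arguments Fps {R} _.

HB.instance Definition _ (R : Type) := [isNew for @fps_coef R].
HB.instance Definition _ (R : choiceType) := [Choice of fps R by <:].

Lemma fpsP (R : Type) (f g : fps R) :
  (forall a, fps_coef f a = fps_coef g a) -> f = g.
Proof. by case: f g => [f] [g] /= fg; congr Fps; apply/funext. Qed.

Section FpsLmodule.
Variable R : comNzRingType.
Implicit Types f g h : fps R.

Definition fps_zero : fps R := Fps (fun=> 0).
Definition fps_opp f : fps R := Fps (fun a => - fps_coef f a).
Definition fps_add f g : fps R := Fps (fun a => fps_coef f a + fps_coef g a).
Definition fps_scale (c : R) f : fps R := Fps (fun a => c * fps_coef f a).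

Fact fps_addA : associative fps_add.
Proof. by move=> f g h; apply: fpsP => a /=; rewrite addrA. Qed.
Fact fps_addC : commutative fps_add.
Proof. by move=> f g; apply: fpsP => a /=; rewrite addrC. Qed.
Fact fps_add0 : left_id fps_zero fps_add.
Proof. by move=> f; apply: fpsP => a /=; rewrite add0r. Qed.
Fact fps_addN : left_inverse fps_zero fps_opp fps_add.
Proof. by move=> f; apply: fpsP => a /=; rewrite addNr. Qed.

HB.instance Definition _ :=
  GRing.isZmodule.Build (fps R) fps_addA fps_addC fps_add0 fps_addN.

Fact fps_scaleA c d f : fps_scale c (fps_scale d f) = fps_scale (c * d) f.
Proof. by apply: fpsP => a /=; rewrite mulrA. Qed.
Fact fps_scale1 : left_id 1 fps_scale.
Proof. by move=> f; apply: fpsP => a /=; rewrite mul1r. Qed.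
Fact fps_scaleDr : right_distributive fps_scale +%R.
Proof. by move=> c f g; apply: fpsP => a /=; rewrite mulrDr. Qed.
Fact fps_scaleDl f : {morph fps_scale^~ f : c d / c + d}.
Proof. by move=> c d; apply: fpsP => a /=; rewrite mulrDl. Qed.

HB.instance Definition _ := GRing.Zmodule_isLmodule.Build R (fps R)
  fps_scaleA fps_scale1 fps_scaleDr fps_scaleDl.

Lemma fps_coef0 a : fps_coef (0 : fps R) a = 0. Proof. by []. Qed.
Lemma fps_coefD f g a : fps_coef (f + g) a = fps_coef f a + fps_coef g a.
Proof. by []. Qed.
Lemma fps_coefZ c f a : fps_coef (c *: f) a = c * fps_coef f a.
Proof. by []. Qed.

End FpsLmodule.

Definition divides (a b : monomial) : Prop := exists c, mmul a c = b.

Lemma dividesP (a b : monomial) :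
  divides a b <-> forall i, (a i <= b i)%N.
Proof.
split=> [[c <-] i|ab]; first by rewrite cmM leq_addr.
exists (divcm b a); apply/eqP/cmP => i.
by rewrite cmM divcmE subnKC.
Qed.

Lemma finite_divides (b : monomial) : finite_set [set a | divides a b].
Proof.
pose n := (\max_(i : finsupp b) b (val i))%N.
pose F (u : {ffun finsupp b -> 'I_n.+1}) : monomial :=
  [cmonom (u i : nat) | i : finsupp b]%M.
apply: (@sub_finite_set _ _ [set F u | u in [set: {ffun finsupp b -> 'I_n.+1}]]);
  last by apply: finite_image; exact: finite_finset.
move=> a /dividesP ab; exists [ffun i => inord (a (val i))] => //.
apply/eqP/cmP => i; rewrite /F cmE.
have [ib|ib] := boolP (i \in finsupp b).
  rewrite fsfun_ffun (insubT (mem (finsupp b)) ib) /= ffunE inordK //=.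
  by rewrite ltnS; apply: leq_trans (ab i) _; exact: (leq_bigmax [` ib]%fset).
rewrite fsfun_ffun insubF; last exact: negbTE.
by apply/esym/eqP; rewrite -leqn0; apply: leq_trans (ab i) _;
  rewrite leqn0 cmE_eq0.
Qed.

Lemma divides_refl (a : monomial) : divides a a.
Proof. by apply/dividesP. Qed.

Lemma divides_trans (a b c : monomial) :
  divides a b -> divides b c -> divides a c.
Proof. by case=> u <- [v <-]; exists (mmul u v); rewrite mulmA. Qed.

Definition monomial_prod (I : Type) (r : seq I) (u : I -> posn) (e : I -> nat) :
    monomial :=
  \big[mmul/mone]_(i <- r) iter (e i) (mmul (ucm (u i))) mone.

Lemma monomial_prodE (I : Type) (r : seq I) (u : I -> posn) (e : I -> nat) j :
  monomial_prod r u e j = (\sum_(i <- r) (u i == j) * e i)%N.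
Proof.
rewrite /monomial_prod; elim: r => [|i r IH]; first by rewrite !big_nil cm1.
rewrite !big_cons cmM IH; congr (_ + _)%N.
by elim: (e i) => [|n IHn]; rewrite ?cm1 ?muln0 //= cmM IHn cmU mulnS.
Qed.

Lemma posn_succ_inj : injective posn_succ.
Proof. by move=> i j /(congr1 val) [] /val_inj. Qed.

Definition shift_mono (a : monomial) : monomial :=
  monomial_prod (finsupp a) posn_succ a.

Lemma shift_mono_succ a i : shift_mono a (posn_succ i) = a i.
Proof.
rewrite monomial_prodE; have [ia|ia] := boolP (i \in finsupp a).
  rewrite (bigD1_seq i) ?fset_uniq //= eqxx mul1n big1 ?addn0 // => j ji.
  by rewrite (inj_eq posn_succ_inj) (negbTE ji).
rewrite (eqP (_ : a i == 0%N)) ?cmE_eq0 // big1_seq // => j /= ja.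
rewrite (inj_eq posn_succ_inj); case: eqVneq => // ji.
by rewrite -ji ja in ia.
Qed.

Lemma shift_mono0 a i : (forall j, posn_succ j != i) -> shift_mono a i = 0%N.
Proof.
by move=> ni; rewrite monomial_prodE big1 // => j _; rewrite (negbTE (ni j)).
Qed.

Lemma shift_mono_inj : injective shift_mono.
Proof.
move=> a b ab; apply/eqP/cmP => i.
by rewrite -(shift_mono_succ a) ab shift_mono_succ.
Qed.

Lemma shift_monoM a b : shift_mono (mmul a b) = mmul (shift_mono a) (shift_mono b).
Proof.
apply/eqP/cmP => i; have [[j <-]|ni] := pselect (exists j, posn_succ j = i).
  by rewrite cmM !shift_mono_succ cmM.
have ni' j : posn_succ j != i by apply/eqP => ji; apply: ni; exists j.
by rewrite cmM !shift_mono0.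
Qed.

Lemma shift_mono1 : shift_mono mone = mone.
Proof. by rewrite /shift_mono /monomial_prod mdom1 big_seq_fset0. Qed.

Lemma shift_monoU i : shift_mono (ucm i) = ucm (posn_succ i).
Proof.
by rewrite /shift_mono /monomial_prod mdomU big_seq_fset1 cmUU /= mulm1.
Qed.

Section FpsAlgebra.
Variable R : comNzRingType.
Implicit Types f g h : fps R.

Definition fps_one : fps R := Fps (fun a => (a == mone)%:R).

(* Cauchy product; each of these sums is finite by [finite_divides]. *)
Definition fps_mul f g : fps R := Fps (fun c =>
  \sum_(p \in [set p : monomial * monomial | mmul p.1 p.2 = c])
    fps_coef f p.1 * fps_coef g p.2).

Lemma fps_coefM_fin f g (b c : monomial) : divides c b ->
  fps_coef (fps_mul f g) c =
  \sum_(p <- fset_set [set a | divides a b])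
    \sum_(q <- fset_set [set a | divides a b] | mmul p q == c)
      fps_coef f p * fps_coef g q.
Proof.
move=> cb; set N := fset_set _.
have inN a : divides a b -> a \in N.
  by move=> ab; rewrite in_fset_set ?inE //; exact: finite_divides.
pose P := [pred p : monomial * monomial | mmul p.1 p.2 == c].
transitivity (\sum_(p \in [set` P]) fps_coef f p.1 * fps_coef g p.2).
  by apply: eq_fsbigl; apply/seteqP; split=> p /eqP.
rewrite -(@bigfs _ _ _ _ [seq (p, q) | p <- N, q <- N]).
- rewrite big_mkcond big_allpairs; apply: eq_bigr => p _.
  by rewrite [RHS]big_mkcond.
- by apply: allpairs_uniq => // -[? ?] [? ?].
move=> [p q] /eqP /= pq /negP[]; apply/allpairsP; exists (p, q).
split=> //; apply: inN; apply: (divides_trans _ cb).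
  by exists q.
by exists p; rewrite mulmC.
Qed.

Fact fps_mulC : commutative fps_mul.
Proof.
move=> f g; apply: fpsP => c; rewrite !(fps_coefM_fin _ _ (divides_refl c)).
under eq_bigr do rewrite big_mkcond.
rewrite exchange_big /=; apply: eq_bigr => p _; rewrite [RHS]big_mkcond.
by apply: eq_bigr => q _; rewrite mulmC mulrC.
Qed.

Fact fps_mul1 : left_id fps_one fps_mul.
Proof.
move=> f; apply: fpsP => c /=.
rewrite -(fsbig_widen [set (mone, c)]) /=.
- by rewrite fsbig_set1 /= eqxx mul1r.
- by move=> p ->; exact: mul1m.
move=> [p q] /= [pq]; have [pe []|_ _] := eqVneq p mone; last by rewrite mul0r.
by rewrite -pq pe; congr pair; exact/esym/mul1m.
Qed.

Fact fps_mulDl : left_distributive fps_mul +%R.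
Proof.
move=> f g h; apply: fpsP => c.
rewrite fps_coefD !(fps_coefM_fin _ _ (divides_refl c)) -big_split /=.
apply: eq_bigr => p _; rewrite -big_split /=.
by apply: eq_bigr => q _; rewrite mulrDl.
Qed.

Fact fps_mulA : associative fps_mul.
Proof.
suff A f g h c : fps_coef (fps_mul f (fps_mul g h)) c =
    \sum_(p <- fset_set [set a | divides a c])
    \sum_(q <- fset_set [set a | divides a c])
    \sum_(r <- fset_set [set a | divides a c])
      (if mmul p (mmul q r) == c
       then fps_coef f p * (fps_coef g q * fps_coef h r) else 0).
  move=> f g h; apply: fpsP => c; rewrite A fps_mulC A.
  rewrite [RHS]exchange_big; apply: eq_bigr => p _ /=.
  rewrite [RHS]exchange_big; apply: eq_bigr => q _ /=.
  apply: eq_bigr => r _.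
  by rewrite [mmul r _]mulmC mulmA [fps_coef h r * _]mulrC mulrA.
rewrite (fps_coefM_fin _ _ (divides_refl c)); set N := fset_set _.
apply: eq_bigr => p _.
transitivity (\sum_(s <- N | mmul p s == c) \sum_(q <- N) \sum_(r <- N)
    (if mmul q r == s then fps_coef f p * (fps_coef g q * fps_coef h r)
     else 0)).
  apply: eq_bigr => s /eqP ps; rewrite (@fps_coefM_fin _ _ c).
    rewrite mulr_sumr; apply: eq_bigr => q _.
    rewrite big_mkcond mulr_sumr; apply: eq_bigr => r _.
    by case: ifP => // _; rewrite mulr0.
  by exists p; rewrite mulmC.
rewrite exchange_big; apply: eq_bigr => q _ /=.
rewrite exchange_big; apply: eq_bigr => r _ /=.
set e := (fps_coef f p * _); transitivity (\sum_(s <- N | s == mmul q r) (if mmul p s == c then e else 0)).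
  rewrite big_mkcond [RHS]big_mkcond; apply: eq_bigr => s _.
  by rewrite [s == _]eq_sym; do 2!case: ifP.
case: ifPn => [/eqP pqr|pqr].
  rewrite big_mkcond (bigD1_seq (mmul q r)) ?fset_uniq //=.
    by rewrite eqxx pqr eqxx big1 ?addr0 // => s /negbTE ->.
  rewrite in_fset_set ?inE; last exact: finite_divides.
  by exists p; rewrite mulmC.
by rewrite big1 // => s /eqP ->; rewrite (negbTE pqr).
Qed.

Fact fps_one_neq0 : fps_one != 0.
Proof.
apply/eqP => /(congr1 (fun f => fps_coef f mone)) /= /eqP.
by rewrite eqxx (negbTE (oner_neq0 R)).
Qed.

HB.instance Definition _ := GRing.Zmodule_isComNzRing.Build (fps R)
  fps_mulA fps_mulC fps_mul1 fps_mulDl fps_one_neq0.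

Fact fps_scaleAl c f g : c *: (f * g) = c *: f * g.
Proof.
apply: fpsP => a; rewrite fps_coefZ !(fps_coefM_fin _ _ (divides_refl a)).
rewrite mulr_sumr; apply: eq_bigr => p _; rewrite mulr_sumr.
by apply: eq_bigr => q _; rewrite mulrA.
Qed.

HB.instance Definition _ :=
  GRing.Lmodule_isLalgebra.Build R (fps R) fps_scaleAl.
HB.instance Definition _ := GRing.Lalgebra_isComAlgebra.Build R (fps R).

Lemma fps_coef1 a : fps_coef (1 : fps R) a = (a == mone)%:R.
Proof. by []. Qed.

Lemma fps_coefM f g c : fps_coef (f * g) c =
  \sum_(p \in [set p : monomial * monomial | mmul p.1 p.2 = c])
    fps_coef f p.1 * fps_coef g p.2.
Proof. by []. Qed.

Definition fps_var (i : posn) : fps R := Fps (fun a => (a == ucm i)%:R).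

(* Infinite sums are taken coefficientwise; they are meaningful only for
   families satisfying [summable], since a finitely supported sum over an
   infinite support is 0 by convention. *)
Definition summable (I : choiceType) (A : set I) (F : I -> fps R) : Prop :=
  forall a, finite_set [set i | A i /\ fps_coef (F i) a != 0].

Definition fps_sum (I : choiceType) (A : set I) (F : I -> fps R) : fps R :=
  Fps (fun a => \sum_(i \in A) fps_coef (F i) a).

Definition fps_subst (u : posn -> fps R) f : fps R :=
  fps_sum [set: monomial]
    (fun a => fps_coef f a *: \prod_(i <- finsupp a) u i ^+ a i).

Definition shift : fps R -> fps R := fps_subst (fun i => fps_var (posn_succ i)).

(* The family is summable for 0 < m, see [summable_Lambda]. *)
Definition Lambda (m : nat) f : fps R :=
  fps_sum [set: posn] (fun k => fps_var k ^+ m * iter (val k) shift f).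

Definition fps_mono (a : monomial) : fps R := Fps (fun b => (b == a)%:R).

Lemma fps_mono1 : fps_mono mone = 1. Proof. by []. Qed.

Lemma fps_monoM a b : fps_mono a * fps_mono b = fps_mono (mmul a b).
Proof.
apply: fpsP => c; rewrite fps_coefM /=.
have [->|abc] := eqVneq c (mmul a b).
  rewrite -(fsbig_widen [set (a, b)]).
  - by rewrite fsbig_set1 !eqxx mulr1.
  - by move=> p ->.
  move=> [p q] [_] /=; have [->|_ _] := eqVneq p a; last by rewrite mul0r.
  by have [->|_ _] := eqVneq q b; last by rewrite mulr0.
rewrite fsbig1 // => -[p q] /= pq.
have [pa|_] := eqVneq p a; last by rewrite mul0r.
have [qb|_] := eqVneq q b; last by rewrite mulr0.
by rewrite -pq pa qb eqxx in abc.
Qed.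

Lemma fps_mono_inj : injective fps_mono.
Proof.
move=> a b /(congr1 (fun f => fps_coef f a)) /=; rewrite eqxx.
by case: eqVneq => // _ /eqP; rewrite oner_eq0.
Qed.

Lemma fps_prod_varX (I : choiceType) (r : seq I) (u : I -> posn) (e : I -> nat) :
  \prod_(i <- r) fps_var (u i) ^+ e i = fps_mono (monomial_prod r u e).
Proof.
have varX k n : fps_var k ^+ n = fps_mono (iter n (mmul (ucm k)) mone).
  by elim: n => //= n IH; rewrite exprS IH -fps_monoM.
rewrite /monomial_prod; elim: r => [|i r IH]; first by rewrite !big_nil.
by rewrite !big_cons IH varX fps_monoM.
Qed.

Lemma summable_Lambda m f : (0 < m)%N ->
  summable [set: posn] (fun k => fps_var k ^+ m * iter (val k) shift f).
Proof.
move=> m0 a; apply: (sub_finite_set _ (finite_fset (finsupp a))).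
move=> k [_]; apply: contraNT => ka; rewrite fps_coefM fsbig1 //.
move=> [p q] /= pqa.
have := fps_prod_varX [:: k] id (fun=> m); rewrite big_seq1 => -> /=.
case: eqVneq => [pb|_]; last by rewrite mul0r.
move: ka; rewrite -cmE_eq0 -pqa pb cmM monomial_prodE big_seq1 eqxx mul1n.
by rewrite addn_eq0 (gtn_eqF m0).
Qed.

End FpsAlgebra.


Section Shift.
Variable R : comNzRingType.
Implicit Types f g : fps R.

Lemma summable_shift f : summable [set: monomial] (fun a =>
  fps_coef f a *: \prod_(i <- finsupp a) fps_var R (posn_succ i) ^+ a i).
Proof.
move=> b; have [[c cb]|nb] := pselect (exists c, shift_mono c = b).
  apply: (sub_finite_set _ (finite_set1 c)) => a [_].
  rewrite fps_prod_varX -/(shift_mono a) fps_coefZ /= -cb.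
  rewrite (inj_eq shift_mono_inj); case: (eqVneq c a) => [->//|_].
  by rewrite mulr0 eqxx.
apply: (sub_finite_set _ (finite_set0 _)) => a [_].
rewrite fps_prod_varX -/(shift_mono a) fps_coefZ /=.
case: (eqVneq b (shift_mono a)) => [ba _|_]; last by rewrite mulr0 eqxx.
by apply: nb; exists a.
Qed.

Lemma shiftE f b : fps_coef (shift f) b =
  \sum_(a \in [set: monomial]) fps_coef f a * (b == shift_mono a)%:R.
Proof. by apply: eq_fsbigr => a _; rewrite fps_prod_varX. Qed.

Lemma shift_coef f a : fps_coef (shift f) (shift_mono a) = fps_coef f a.
Proof.
rewrite shiftE -(fsbig_widen [set a]) //.
  by rewrite fsbig_set1 eqxx mulr1.
move=> c [_] /= ca; rewrite (inj_eq shift_mono_inj).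
by case: eqVneq => [/esym//|_]; rewrite mulr0.
Qed.

Lemma shift_coef0 f b : ~ (exists a, shift_mono a = b) ->
  fps_coef (shift f) b = 0.
Proof.
move=> nb; rewrite shiftE fsbig1 // => a _.
by case: eqVneq => [ba|_]; rewrite ?mulr0 //; case: nb; exists a.
Qed.

Fact shift_is_linear : linear (@shift R).
Proof.
move=> c f g; apply: fpsP => b; rewrite fps_coefD fps_coefZ.
have [[a <-]|nb] := pselect (exists a, shift_mono a = b).
  by rewrite !shift_coef fps_coefD fps_coefZ.
by rewrite !shift_coef0 // mulr0 addr0.
Qed.

HB.instance Definition _ :=
  GRing.isLinear.Build R (fps R) (fps R) *:%R (@shift R) shift_is_linear.

Fact shift_is_monoid_morphism : monoid_morphism (@shift R).
Proof.
split=> [|f g]; apply: fpsP => b.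
  have [[a <-]|nb] := pselect (exists a, shift_mono a = b).
    by rewrite shift_coef !fps_coef1 -(inj_eq shift_mono_inj) shift_mono1.
  rewrite shift_coef0 // fps_coef1; case: eqVneq => // b1.
  by case: nb; exists mone; rewrite shift_mono1.
have [[c <-]|nb] := pselect (exists a, shift_mono a = b).
  rewrite shift_coef !fps_coefM.
  pose sh (p : monomial * monomial) := (shift_mono p.1, shift_mono p.2).
  have sh_inj : injective sh.
    by move=> [? ?] [? ?] [/shift_mono_inj -> /shift_mono_inj ->].
  rewrite -[RHS](fsbig_widen (sh @` [set p | mmul p.1 p.2 = c])).
  - rewrite fsbig_image; last by move=> ? ? _ _ /sh_inj.
    by apply: eq_fsbigr => p _; rewrite !shift_coef.
  - by move=> _ [p /= <- <-]; rewrite /= shift_monoM.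
  move=> [p q] /= [pq npq].
  suff: fps_coef (shift f) p * fps_coef (shift g) q = 0 by [].
  have [[p' pE]|np] := pselect (exists a, shift_mono a = p); last first.
    by rewrite (shift_coef0 _ np) mul0r.
  have [[q' qE]|nq] := pselect (exists a, shift_mono a = q); last first.
    by rewrite (shift_coef0 _ nq) mulr0.
  case: npq; exists (p', q'); rewrite /sh /= ?pE ?qE //.
  by apply: shift_mono_inj; rewrite shift_monoM pE qE.
rewrite (shift_coef0 _ nb) fps_coefM fsbig1 // => -[p q] /= pq.
suff: fps_coef (shift f) p * fps_coef (shift g) q = 0 by [].
have [[p' pE]|np] := pselect (exists a, shift_mono a = p); last first.
  by rewrite (shift_coef0 _ np) mul0r.
have [[q' qE]|nq] := pselect (exists a, shift_mono a = q); last first.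
  by rewrite (shift_coef0 _ nq) mulr0.
by case: nb; exists (mmul p' q'); rewrite shift_monoM pE qE.
Qed.

HB.instance Definition _ := GRing.isMonoidMorphism.Build (fps R) (fps R)
  (@shift R) shift_is_monoid_morphism.

Lemma shift_var i : shift (fps_var R i) = fps_var R (posn_succ i).
Proof.
apply: fpsP => b; have [[a <-]|nb] := pselect (exists a, shift_mono a = b).
  by rewrite shift_coef /= -shift_monoU (inj_eq shift_mono_inj).
rewrite shift_coef0 //=; case: eqVneq => // bi.
by case: nb; exists (ucm i); rewrite shift_monoU.
Qed.

End Shift.

(* A labeled poset is given by a finite poset [P] and an injective
   [w : P -> posn]. *)
Section Subposet.
Variables (d : Order.disp_t) (P : finPOrderType d).

Definition subposet (S : {set P}) : Type := {x : P | x \in S}.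

HB.instance Definition _ (S : {set P}) := SubFinite.on (subposet S).
HB.instance Definition _ (S : {set P}) :=
  [SubChoice_isSubPOrder of subposet S by <: with d].

Definition sublabel (S : {set P}) (w : P -> posn) : subposet S -> posn :=
  w \o val.

End Subposet.

Section LabeledPoset.
Variables (d : Order.disp_t) (P : finPOrderType d) (w : P -> posn).
Implicit Types (S : {set P}) (s : {ffun P -> posn}).

Definition ideal S : bool :=
  [forall x, forall y, (x <= y)%O && (y \in S) ==> (x \in S)].

Definition natural S : bool :=
  [forall x in S, forall y in S, (x <= y)%O ==> (w x <= w y)%O].

Definition natural_ideals : {set {set P}} :=
  [set S : {set P} | ideal S && natural S]%SET.

Definition w_order_preserving s : Prop :=
  (forall x y, (x <= y)%O -> (s x <= s y)%O) /\
  (forall x y, (y < x)%O -> (w x < w y)%O -> (s y < s x)%O).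

Definition fps_weight (R : comNzRingType) s : fps R :=
  \big[*%R/1]_(i \in [set: posn]) fps_var R i ^+ #|[pred x | s x == i]|.

Definition K (R : comNzRingType) : fps R :=
  fps_sum [set s | w_order_preserving s] (@fps_weight R).

Lemma fps_weightE (R : comNzRingType) s :
  fps_weight R s = \prod_(x : P) fps_var R (s x).
Proof.
rewrite /fps_weight (fsbigTE [fset s x | x in P]%fset) /=; last first.
  move=> i /imfsetP si; rewrite [X in _ ^+ X](_ : _ = 0%N) //.
  apply: eq_card0 => x; rewrite inE /=.
  by apply/eqP => sx; apply: si; exists x.
under [LHS]eq_bigr => i _.
  rewrite -prodr_const (eq_bigr (fun x => fps_var R (s x))); last first.
    by move=> x; rewrite inE => /eqP ->.
  under eq_bigl do rewrite inE; rewrite big_mkcond; over.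
rewrite exchange_big; apply: eq_bigr => x _ /=.
rewrite (bigD1_seq (s x)) ?fset_uniq ?in_imfset //= eqxx.
by rewrite big1 ?mulr1 // => i; rewrite eq_sym => /negbTE ->.
Qed.

Lemma summable_K (R : comNzRingType) :
  summable [set s | w_order_preserving s] (@fps_weight R).
Proof.
move=> a; pose F (u : {ffun P -> finsupp a}) : {ffun P -> posn} :=
  [ffun x => val (u x)].
apply: (@sub_finite_set _ _ [set F u | u in [set: {ffun P -> finsupp a}]]);
  last by apply: finite_image; exact: finite_finset.
move=> s [_]; rewrite fps_weightE.
under eq_bigr do rewrite -[fps_var R _]expr1.
rewrite fps_prod_varX /=; case: (eqVneq a) => [aE _|_]; last by rewrite eqxx.
have sa x : s x \in finsupp a.
  by rewrite -cmE_neq0 aE monomial_prodE (bigD1 x) //= eqxx.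
by exists [ffun x => [` sa x]%fset] => //; apply/ffunP => x; rewrite !ffunE.
Qed.

End LabeledPoset.

(* Main.v *)
(* For an omega-order-preserving sigma with least value k, the set
   S = sigma^-1(k) is a nonempty omega-natural ideal.  For each such ideal S,
   sigma |-> (k, tau) with tau = sigma - k on P \ S is a bijection from the maps
   attaining their least value exactly on S to the pairs of a positive integer
   and an omega-order-preserving map on P \ S, and
   x^sigma = x_k^|S| T^k(x^tau).  Summing over k and tau gives
   Lambda_|S| K(P \ S), and summing over S gives K(P). *)
Require Import Defs.
From mathcomp Require Import finmap boolp classical_sets cardinality fsbigop.
From mathcomp.multinomials Require Import monalg.
From mathcomp Require Import all_boot all_order all_algebra.
From mathcomp Require Import reals complex.

Set Implicit Arguments.
Unset Strict Implicit.
Unset Printing Implicit Defensive.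

Local Open Scope ring_scope.

(** * Series that are sums of monomials over an index set *)

Section MonomialSums.
Import GRing.Theory.
Local Open Scope classical_set_scope.
Variable R : comNzRingType.
Implicit Types (a b : monomial) (f : fps R).

Lemma mmulmI a : injective (mmul a).
Proof.
move=> b c abc; apply/eqP/cmP => i; apply: (@addnI (a i)).
by rewrite -!cmM abc.
Qed.

Lemma fps_coef_monoM a f b :
  fps_coef (fps_mono R a * f) (mmul a b) = fps_coef f b.
Proof.
rewrite fps_coefM -(fsbig_widen [set (a, b)]).
- by rewrite fsbig_set1 /= eqxx mul1r.
- by move=> p ->.
move=> [p q] /= [pq]; have [pa []|_ _] := eqVneq p a; last by rewrite mul0r.
by rewrite pa in pq *; rewrite (mmulmI pq).
Qed.

Lemma fps_coef_monoM0 a f b :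
  ~ divides a b -> fps_coef (fps_mono R a * f) b = 0.
Proof.
move=> nab; rewrite fps_coefM fsbig1 // => -[p q] /= pq.
have [pa|_] := eqVneq p a; last by rewrite mul0r.
by case: nab; exists q; rewrite -pa.
Qed.

(** Replaces a finitely supported sum by an ordinary one over any list covering the support, so that
    sums can be nested and partitioned. *)
Lemma fsbig_sumE (I : choiceType) (A : set I) (r : seq I) (F : I -> R) :
    uniq r -> [set` r] `<=` A -> (forall i, A i -> i \notin r -> F i = 0) ->
  \sum_(i \in A) F i = \sum_(i <- r) F i.
Proof.
move=> r_uniq rA F0; rewrite [RHS]fsbig_seq //; apply/esym/fsbig_widen => //.
by move=> i [Ai /negP]; exact: F0.
Qed.

(** The generating function of [A] by the weight [u]: the coefficient at [b] counts the fibre of [u]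
    over [b], and is 0 by convention if that fibre is infinite. *)
Definition mono_sum (I : choiceType) (A : set I) (u : I -> monomial) : fps R :=
  fps_sum A (fun i => fps_mono R (u i)).

Lemma mono_sumE (I : choiceType) (A : set I) (u : I -> monomial) b :
  fps_coef (mono_sum A u) b = \sum_(i \in A) ((b == u i)%:R : R).
Proof. by []. Qed.

Lemma monoM_mono_sum a (I : choiceType) (A : set I) (u : I -> monomial) :
  fps_mono R a * mono_sum A u = mono_sum A (fun i => mmul a (u i)).
Proof.
apply: fpsP => b; rewrite mono_sumE.
have [[c <-]|nab] := pselect (divides a b).
  rewrite fps_coef_monoM mono_sumE; apply: eq_fsbigr => i _.
  by rewrite (inj_eq (@mmulmI a)).
rewrite fps_coef_monoM0 // fsbig1 // => i _.
by case: eqVneq => // bE; case: nab; exists (u i).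
Qed.

Lemma shift_mono_sum (I : choiceType) (A : set I) (u : I -> monomial) :
  shift (mono_sum A u) = mono_sum A (fun i => shift_mono (u i)).
Proof.
apply: fpsP => b; rewrite mono_sumE.
have [[c <-]|nb] := pselect (exists c, shift_mono c = b).
  rewrite shift_coef mono_sumE; apply: eq_fsbigr => i _.
  by rewrite (inj_eq shift_mono_inj).
rewrite shift_coef0 // fsbig1 // => i _.
by case: eqVneq => // bE; case: nb; exists (u i).
Qed.

Lemma iter_shift_mono_sum k (I : choiceType) (A : set I) (u : I -> monomial) :
  iter k (@shift R) (mono_sum A u) =
  mono_sum A (fun i => iter k shift_mono (u i)).
Proof. by elim: k => //= k ->; rewrite shift_mono_sum. Qed.

(** A Fubini rule. Finite fibres keep the convention for infinite supports from entering either the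
    iterated or the joint sum. *)
Lemma fps_sum_mono_sum (J I : choiceType) (A : set I)
    (v : J -> I -> monomial) :
  (forall b, finite_set [set p : J * I | A p.2 /\ v p.1 p.2 = b]) ->
  fps_sum [set: J] (fun k => mono_sum A (v k)) =
  mono_sum ([set: J] `*` A) (fun p => v p.1 p.2).
Proof.
move=> vfin; apply: fpsP => b /=; rewrite [RHS]mono_sumE.
pose X := fset_set [set p : J * I | A p.2 /\ v p.1 p.2 = b].
have inX k i : A i -> v k i = b -> (k, i) \in X.
  by move=> Ai vb; rewrite in_fset_set //; apply/mem_set.
have XA k i : (k, i) \in X -> A i by rewrite in_fset_set // => /set_mem[].
(* The rectangle [X1] × [X2] contains the fibre over [b], so both sums reduce to it. *)
pose X1 := [fset p.1 | p in X]%fset; pose X2 := [fset p.2 | p in X]%fset.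
have X2A : [set` X2] `<=` A by move=> _ /= /imfsetP[[k i] /= /XA Ai ->].
have v0 k i : A i -> k \notin X1 \/ i \notin X2 -> (b == v k i)%:R = 0 :> R.
  move=> Ai nki; case: eqVneq => // vb; case: nki => /negP[];
  by apply/imfsetP; exists (k, i); rewrite ?inX.
transitivity (\sum_(k <- X1) \sum_(i <- X2) (b == v k i)%:R : R).
  transitivity (\sum_(k <- X1) \sum_(i \in A) ((b == v k i)%:R : R)).
    apply: fsbig_sumE; rewrite ?fset_uniq // => k _ kX.
    by apply: fsbig1 => i Ai; apply: v0 => //; left.
  apply: eq_bigr => k _; apply: fsbig_sumE; rewrite ?fset_uniq // => i Ai iX.
  by apply: v0 => //; right.
apply: esym; rewrite (fsbig_sumE (r := [seq (k, i) | k <- X1, i <- X2])).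
- by rewrite big_allpairs.
- by apply: allpairs_uniq; rewrite ?fset_uniq // => -[? ?] [? ?].
- by move=> _ /allpairsP[[k i] [/= kX iX ->]]; split=> //; exact: X2A.
move=> [k i] [_ /= Ai] /negP nki; apply: v0 => //.
case: (boolP (k \in X1)) => kX; last by left.
case: (boolP (i \in X2)) => iX; last by right.
by case: nki; apply/allpairsP; exists (k, i).
Qed.

End MonomialSums.

(** * The monomial of a map, and K as a sum of such monomials *)

Section Weight.
Local Open Scope classical_set_scope.

(** The exponent vector of $x^\sigma$, taken for plain functions so that it also applies to shifted
    maps. *)
Definition weight_mono (I : finType) (s : I -> posn) : monomial :=
  \big[mmul/mone]_(x : I) ucm (s x).

Lemma fps_weight_mono (R : comNzRingType) d (P : finPOrderType d)
    (s : {ffun P -> posn}) : fps_weight R s = fps_mono R (weight_mono s).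
Proof.
rewrite fps_weightE /weight_mono.
by apply: (big_ind2 (fun f a => f = fps_mono R a)) => // _ a _ b -> ->;
  rewrite fps_monoM.
Qed.

Lemma K_mono_sum (R : comNzRingType) d (P : finPOrderType d) (w : P -> posn) :
  K w R = mono_sum R [set s | w_order_preserving w s]
            (fun s => weight_mono s).
Proof.
by apply: fpsP => b; apply: eq_fsbigr => s _; rewrite fps_weight_mono.
Qed.

Lemma finite_weight_mono d (P : finPOrderType d) (w : P -> posn) b :
  finite_set [set s : {ffun P -> posn} |
    w_order_preserving w s /\ weight_mono s = b].
Proof.
(* The statement mentions no ring; over [int], a map of weight [b] has coefficient 1, which is
   nonzero. *)
apply: sub_finite_set (summable_K w int b) => s [ws sb]; split=> //.
by rewrite fps_weight_mono /= sb eqxx.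
Qed.

Lemma iter_shift_mono_weight k (I : finType) (s : I -> posn) :
  iter k shift_mono (weight_mono s) =
  weight_mono (fun x => iter k posn_succ (s x)).
Proof.
elim: k => //= k ->; rewrite /weight_mono.
by rewrite (big_morph _ shift_monoM shift_mono1); apply: eq_bigr => x _;
  rewrite shift_monoU.
Qed.

End Weight.

Lemma val_iter_posn_succ n i : val (iter n posn_succ i) = (n + val i)%N.
Proof. by elim: n => //= n ->. Qed.

Lemma ltEposn (i j : posn) : (i < j)%O = (val i < val j)%N.
Proof. by []. Qed.

(** * Splitting a map at its least value and gluing it back *)

Section Gluing.
Import Order.TTheory GRing.Theory.
Variables (d : Order.disp_t) (P : finPOrderType d) (w : P -> posn).
Implicit Types (S : {set P}) (s : {ffun P -> posn}).

Lemma natural_idealsP S :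
  reflect ((forall x y, (x <= y)%O -> y \in S -> x \in S) /\
           {in S &, forall x y, (x <= y)%O -> (w x <= w y)%O})
          (S \in natural_ideals w).
Proof.
rewrite inE; apply: (iffP andP) => -[idS natS]; split.
- move=> x y xy yS; have /forallP/(_ y)/implyP := forallP idS x.
  by apply; rewrite xy.
- move=> x y xS yS; apply/implyP.
  by have /'forall_implyP/(_ x xS)/'forall_implyP := natS; apply.
- apply/forallP => x; apply/forallP => y; apply/implyP => /andP[].
  exact: idS.
apply/'forall_implyP => x xS; apply/'forall_implyP => y yS; apply/implyP.
exact: natS.
Qed.

Definition minset s : {set P} := [set x | [forall y, (s x <= s y)%O]]%SET.

Lemma minsetP s x : reflect (forall y, (s x <= s y)%O) (x \in minset s).
Proof. by rewrite inE; apply: forallP. Qed.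

Lemma minset_neq0 s : (0 < #|P|)%N -> minset s != set0.
Proof.
case/card_gt0P => x0 _; apply/set0Pn.
case: (@Order.TotalTheory.arg_minP _ _ _ x0 predT s isT) => x _ xmin.
by exists x; apply/minsetP => y; exact: xmin.
Qed.

(** Monotonicity gives down-closure. If [x <= y] were both minimizers with [w y < w x], strictness
    would give [s x < s y], against minimality at [y]. *)
Lemma minset_natural_ideal s :
  w_order_preserving w s -> minset s \in natural_ideals w.
Proof.
case=> smono sstrict; apply/natural_idealsP; split=> [x y xy /minsetP sy|x y].
  by apply/minsetP => z; exact: le_trans (smono _ _ xy) (sy z).
move=> _ /minsetP sy xy; rewrite leNgt; apply/negP => wyx.
have := sstrict y x; rewrite lt_neqAle xy andbT.
case: (eqVneq x y) wyx => [->|_ wyx]; first by rewrite ltxx.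
by move=> /(_ isT wyx); rewrite ltNge sy.
Qed.

(** The inverse of the splitting: [insub] fails exactly on [S], which gets the value [k]; elsewhere
    [t] is raised by [k]. *)
Definition glue S (k : posn) (t : {ffun subposet (~: S) -> posn}) :
    {ffun P -> posn} :=
  [ffun x => if insub x is Some y then iter (val k) posn_succ (t y) else k].

Lemma glue_in S k (t : {ffun subposet (~: S) -> posn}) x :
  x \in S -> glue k t x = k.
Proof. by move=> xS; rewrite ffunE insubF // inE xS. Qed.

Lemma glue_val S k (t : {ffun subposet (~: S) -> posn}) y :
  glue k t (val y) = iter (val k) posn_succ (t y).
Proof. by rewrite ffunE valK. Qed.

Lemma glue_gt S k (t : {ffun subposet (~: S) -> posn}) x :
  x \notin S -> (k < glue k t x)%O.
Proof.
rewrite -in_setC => xS; rewrite -[x]/(val (Sub x xS : subposet (~: S))).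
rewrite glue_val; set i := t _.
(* Strictness comes from the values of [t] being at least 1. *)
by rewrite ltEposn val_iter_posn_succ -[X in (X < _)%N]addn0 ltn_add2l (valP i).
Qed.

Lemma minset_glue S k (t : {ffun subposet (~: S) -> posn}) :
  S != set0 -> minset (glue k t) = S.
Proof.
case/set0Pn => x0 x0S; apply/setP => x; apply/minsetP/idP.
  move=> xmin; apply: contraT => /(glue_gt k t).
  by have := xmin x0; rewrite (glue_in k t x0S) ltNge => ->.
move=> xS y; rewrite glue_in //.
by have [yS|/(glue_gt k t)/ltW //] := boolP (y \in S); rewrite glue_in.
Qed.

(** A point of [S] reveals [k]; cancelling [k] off [S] then recovers [t]. *)
Lemma glue_inj S k (t : {ffun subposet (~: S) -> posn}) k' t' :
  S != set0 -> glue k t = glue k' t' -> (k, t) = (k', t').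
Proof.
case/set0Pn => x0 x0S /ffunP tt'.
have kk' : k = k' by have := tt' x0; rewrite !glue_in.
rewrite -kk' in tt' *; congr pair; apply/ffunP => y.
have := tt' (val y); rewrite !glue_val => /(congr1 val).
by rewrite !val_iter_posn_succ => /addnI/val_inj.
Qed.

(** Pairs inside the complement are handled by [t]. The ideal property excludes a pair descending
    from [S] to its complement, and naturality excludes a strictness condition inside [S]; in the
    remaining pairs the smaller element has the least value [k]. *)
Lemma glue_w_order_preserving S k (t : {ffun subposet (~: S) -> posn}) :
  S \in natural_ideals w -> w_order_preserving (sublabel (S := ~: S) w) t ->
  w_order_preserving w (glue k t).
Proof.
case/natural_idealsP => idS natS [tmono tstrict]; split=> x y xy.
  have [xS|xS] := boolP (x \in S).
    rewrite glue_in //.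
    by have [yS|/(glue_gt k t)/ltW //] := boolP (y \in S); rewrite glue_in.
  have yS : y \notin S.
    by apply: contra xS; exact: idS.
  rewrite -!in_setC in xS yS *.
  rewrite -[x]/(val (Sub x xS : subposet (~: S))).
  rewrite -[y]/(val (Sub y yS : subposet (~: S))).
  rewrite !glue_val leNgt ltEposn !val_iter_posn_succ ltn_add2l -ltEposn -leNgt.
  exact: tmono.
move=> wxy; have [yS|yS] := boolP (y \in S).
  rewrite (glue_in k t yS); apply: glue_gt; apply: contraL wxy => xS.
  by rewrite -leNgt; apply: natS => //; exact: ltW.
have xS : x \notin S.
  by apply: contra yS; apply: idS; exact: ltW.
rewrite -!in_setC in xS yS *.
rewrite -[x]/(val (Sub x xS : subposet (~: S))).
rewrite -[y]/(val (Sub y yS : subposet (~: S))).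
rewrite !glue_val ltEposn !val_iter_posn_succ ltn_add2l -ltEposn.
exact: tstrict.
Qed.

Lemma glue_surj S s : w_order_preserving w s -> minset s = S -> S != set0 ->
  exists k (t : {ffun subposet (~: S) -> posn}),
    w_order_preserving (sublabel (S := ~: S) w) t /\ glue k t = s.
Proof.
move=> [smono sstrict] sS /set0Pn[x0 x0S].
have SP x : reflect (forall y, (s x <= s y)%O) (x \in S).
  by rewrite -sS; exact: minsetP.
have sS0 x : x \in S -> s x = s x0.
  by move=> xS; apply/le_anti; rewrite (SP _ xS) (SP _ x0S).
(* Off [S] the value exceeds the minimum, so subtracting the minimum stays in [posn] and yields
   [t]. *)
have gt0 (y : subposet (~: S)) : (0 < val (s (val y)) - val (s x0))%N.
  rewrite subn_gt0 -ltEposn ltNge; apply/negP => yx0.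
  have := valP y; rewrite inE => /SP[] z.
  exact: le_trans yx0 (SP _ x0S z).
pose t : {ffun subposet (~: S) -> posn} :=
  [ffun y => exist (fun n => 0 < n)%N _ (gt0 y)].
have tE y : iter (val (s x0)) posn_succ (t y) = s (val y).
  apply: val_inj; rewrite val_iter_posn_succ ffunE /= subnKC //.
  by have := gt0 y; rewrite subn_gt0 => /ltnW.
have tlt y z : (t y < t z)%O = (s (val y) < s (val z))%O.
  by rewrite -!tE !ltEposn !val_iter_posn_succ ltn_add2l.
exists (s x0), t; split.
  split=> y z yz; last by move=> wyz; rewrite tlt; exact: sstrict.
  by rewrite leNgt tlt -leNgt; exact: smono.
apply/ffunP => x; have [xS|] := boolP (x \in S); first by rewrite glue_in ?sS0.
rewrite -in_setC => xS; rewrite -[x]/(val (Sub x xS : subposet (~: S))).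
by rewrite glue_val tE.
Qed.

Lemma weight_mono_glue S k (t : {ffun subposet (~: S) -> posn}) :
  weight_mono (glue k t) =
  mmul (iter #|S| (mmul (ucm k)) mone)
       (iter (val k) shift_mono (weight_mono t)).
Proof.
rewrite iter_shift_mono_weight /weight_mono.
(* [S] contributes $x_k^{|S|}$; its complement contributes the shifted weight of [t]. *)
rewrite (bigID (mem S)) /=; congr mmul.
  by rewrite (eq_bigr (fun=> ucm k)) ?big_const // => x xS; rewrite glue_in.
rewrite (eq_bigl (mem (~: S))) => [|x]; last by rewrite /= inE.
rewrite big_sub; apply: eq_bigr => y _; congr ucm; exact: (glue_val k t y).
Qed.

End Gluing.

(** * Each Lambda term as a sum over maps with a fixed minimizer set, and the recursion *)

Section Recursion.
Import GRing.Theory.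
Local Open Scope classical_set_scope.
Variables (d : Order.disp_t) (P : finPOrderType d) (w : P -> posn).
Variable R : comNzRingType.

Lemma Lambda_K_mono_sum (S : {set P}) :
  S \in natural_ideals w -> S != set0 ->
  Lambda #|S| (K (sublabel (S := ~: S) w) R) =
  mono_sum R [set s | w_order_preserving w s /\ minset s = S]
    (fun s => weight_mono s).
Proof.
move=> SI S0; pose W := sublabel (S := ~: S) w.
pose g (p : posn * {ffun subposet (~: S) -> posn}) := glue p.1 p.2.
have g_inj : injective g by move=> [k t] [k' t']; exact: glue_inj.
rewrite K_mono_sum -/W /Lambda.
transitivity (fps_sum [set: posn] (fun k =>
    mono_sum R [set t | w_order_preserving W t]
      (fun t => weight_mono (g (k, t))))).
  congr fps_sum; apply/funext => k; rewrite iter_shift_mono_sum.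
  have := fps_prod_varX R [:: k] id (fun=> #|S|).
  rewrite big_seq1 => ->; rewrite /monomial_prod big_seq1 monoM_mono_sum.
  by congr mono_sum; apply/funext => t; rewrite weight_mono_glue.
rewrite fps_sum_mono_sum => [|b].
  apply: fpsP => b; rewrite !mono_sumE; apply: esym.
  (* Gluing is the bijection from pairs [(k, t)] onto the maps whose minimizer set is [S]. *)
  rewrite (@reindex_fsbig _ _ _ _ _ g
    ([set: posn] `*` [set t | w_order_preserving W t])).
    by apply: eq_fsbigr => -[k t].
  split=> [[k t] [_ /= Wt]|? ? _ _ /g_inj //|s [ws sS]] /=.
    by split; [exact: glue_w_order_preserving|exact: minset_glue].
  by have [k [t [Wt <-]]] := glue_surj ws sS S0; exists (k, t).
(* The finite fibres required by the Fubini rule are pulled back along the injection [g]. *)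
have := finite_preimage (in2W g_inj) (finite_weight_mono w b).
apply: sub_finite_set => -[k t] [/= Wt tb]; split=> //.
exact: glue_w_order_preserving.
Qed.

Lemma K_recursion : (0 < #|P|)%N ->
  K w R = \sum_(S in natural_ideals w | S != set0)
    Lambda #|S| (K (sublabel (S := ~: S) w) R).
Proof.
move=> P0; apply: fpsP => b.
have -> (r : seq {set P}) (Q : pred {set P}) (F : {set P} -> fps R) :
    fps_coef (\sum_(S <- r | Q S) F S) b =
    \sum_(S <- r | Q S) fps_coef (F S) b.
  by apply: (big_ind2 (fun f c => fps_coef f b = c)) => // f c f' c' <- <-.
(* Only the finitely many maps of weight [b] matter for this coefficient; they are then partitioned
   by [minset]. *)
pose r := fset_set [set s : {ffun P -> posn} |
  w_order_preserving w s /\ weight_mono s = b].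
have inr s : (s \in r) = `[< w_order_preserving w s /\ weight_mono s = b >].
  rewrite in_fset_set; last exact: finite_weight_mono.
  by apply/idP/asboolP => [/set_mem|?] //; apply/mem_set.
rewrite K_mono_sum mono_sumE (fsbig_sumE (r := r)) ?fset_uniq //; first last.
- move=> s ws; rewrite inr; case: eqVneq => // sb /asboolP[]; split=> //.
- by move=> s /=; rewrite inr => /asboolP[].
(* Membership in [r] is kept in the condition: it supplies the order preservation that makes each
   [minset] a natural ideal. *)
rewrite big_seq_cond.
rewrite (partition_big (@minset _ P)
  (fun S => (S \in natural_ideals w) && (S != set0))); last first.
  move=> s; rewrite inr andbT => /asboolP[ws _].
  by rewrite minset_natural_ideal ?minset_neq0.
apply: eq_bigr => S /andP[SI S0].
rewrite Lambda_K_mono_sum // mono_sumE.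
rewrite (fsbig_sumE (r := [seq s <- r | minset s == S])).
- by rewrite big_filter [RHS]big_seq_cond; apply: eq_bigl => s; rewrite andbT.
- by rewrite filter_uniq ?fset_uniq.
- by move=> s /=; rewrite mem_filter inr => /andP[/eqP ? /asboolP[]].
move=> s [ws sS]; rewrite mem_filter inr sS eqxx /=.
by case: eqVneq => // sb /asboolP[].
Qed.

End Recursion.

Theorem proposition3p6 (R : realType) (d : Order.disp_t) (P : finPOrderType d)
    (w : P -> posn) (w_inj : injective w) (P_nonempty : (0 < #|P|)%N) :
  K w R[i] =
    \sum_(S in natural_ideals w | S != set0)
      Lambda #|S| (K (sublabel (S := ~: S) w) R[i]).
Proof. exact: K_recursion. Qed.
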